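(* Let $\mathcal{U}$ be a unital Hopf algebra with a bialgebra filtration $(\mathcal{U}^m)_{m\in\mathbb{N}}$, let $\mathcal{A}$ be a left $\mathcal{U}$-module algebra with action $\triangleright$, and let $\mathcal{D}=\mathcal{A}\#\mathcal{U}$ be the crossed-product algebra, filtered by putting $\mathcal{A}$ in degree $0$. Let $C\in\mathcal{U}$ be a central element of order $r$ whose coproduct has the form $$\boldsymbol{\Delta}(C)=K^r\otimes C+\sum_{j=1}^r c_j\otimes c'_{r-j}$$ for some $K\in\mathcal{U}^0$, where each $c_j\otimes c'_{r-j}$ denotes an element of $\mathcal{U}^j\otimes\mathcal{U}^{r-j}$. Define the linear map $\theta:\mathcal{A}\#\mathcal{U}\to\mathcal{A}\#\mathcal{U}$ by $\theta(ah)=(K\triangleright a)h$ for $a\in\mathcal{A}$, $h\in\mathcal{U}$, extended linearly. Then $[C,\mathcal{D}^m]_{\theta^r}\subseteq\mathcal{D}^{m+r-1}$ for all $m\in\mathbb{N}$.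
   Context: $\boldsymbol{\Delta}$ denotes the coproduct of $\mathcal{U}$. The crossed product $\mathcal{A}\#\mathcal{U}$ is the algebra generated by $\mathcal{A}$ and $\mathcal{U}$ with relations $ha=(h_{(1)}\triangleright a)h_{(2)}$ for $a\in\mathcal{A}$, $h\in\mathcal{U}$ (Sweedler notation); as a vector space it is $\mathcal{A}\otimes\mathcal{U}$ via $a\otimes h\mapsto ah$. A bialgebra filtration is an $\mathbb{N}$-filtration which is both an algebra filtration ($\mathcal{U}^i\mathcal{U}^j\subseteq\mathcal{U}^{i+j}$) and a coalgebra filtration ($\boldsymbol{\Delta}(\mathcal{U}^m)\subseteq\sum_{j=0}^m\mathcal{U}^j\otimes\mathcal{U}^{m-j}$). The filtration of $\mathcal{D}$ is $\mathcal{D}^m=\mathcal{A}\,\mathcal{U}^m$ (linear span). ''Of order $r$'' means $C\in\mathcal{U}^r$, with $r\geq 2$ an integer. The twisted commutator is $[x,y]_{\theta^r}:=xy-\theta^r(y)x$. *)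

(* Defs.v *)
From HB Require Import structures.
From mathcomp Require Import all_boot all_order all_algebra.
From mathcomp Require Import boolp classical_sets.

Set Implicit Arguments.
Unset Strict Implicit.
Unset Printing Implicit Defensive.

Import GRing.Theory.
Local Open Scope quotient_scope.
Local Open Scope ring_scope.

Reserved Notation "u ⊗ v" (at level 41, right associativity).
Reserved Notation "h ▷ a" (at level 38, right associativity).

(* Tensor products of vector spaces of arbitrary dimension: finite formal     *)
(* sums of pairs, modulo the congruence generated by the bilinearity          *)
(* relations.                                                                 *)
Section TensorDef.
Variables (k : fieldType) (U V : lmodType k).

Inductive tensor_eq : seq (U * V) -> seq (U * V) -> Prop :=
| Teq_refl s : tensor_eq s s
| Teq_sym s t : tensor_eq s t -> tensor_eq t s
| Teq_trans s t w : tensor_eq s t -> tensor_eq t w -> tensor_eq s w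
| Teq_cat s s' t t' :
    tensor_eq s s' -> tensor_eq t t' -> tensor_eq (s ++ t) (s' ++ t')
| Teq_catC s t : tensor_eq (s ++ t) (t ++ s)
| Teq_addl u u' v : tensor_eq [:: (u + u', v)] [:: (u, v); (u', v)]
| Teq_addr u v v' : tensor_eq [:: (u, v + v')] [:: (u, v); (u, v')]
| Teq_scale c u v : tensor_eq [:: (c *: u, v)] [:: (u, c *: v)]
| Teq_zero u : tensor_eq [:: (u, 0)] [::].

Definition tensor_eqb (s t : seq (U * V)) : bool := `[< tensor_eq s t >].

Lemma tensor_eqb_refl : reflexive tensor_eqb.
Proof. by move=> s; apply/asboolP; exact: Teq_refl. Qed.

Lemma tensor_eqb_sym : symmetric tensor_eqb.
Proof. by move=> s t; apply/asboolP/asboolP; exact: Teq_sym. Qed.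

Lemma tensor_eqb_trans : transitive tensor_eqb.
Proof.
by move=> t s w /asboolP st /asboolP tw; apply/asboolP; exact: Teq_trans tw.
Qed.

Canonical tensor_equiv :=
  EquivRel tensor_eqb tensor_eqb_refl tensor_eqb_sym tensor_eqb_trans.

Definition tensor := {eq_quot tensor_equiv}.

HB.instance Definition _ := Choice.on tensor.
HB.instance Definition _ := EqQuotient.on tensor.

Definition tclass (s : seq (U * V)) : tensor := \pi_tensor s.

Definition tensor_add (x y : tensor) : tensor := tclass (repr x ++ repr y).
Definition tensor_scale (c : k) (x : tensor) : tensor :=
  tclass [seq (c *: p.1, p.2) | p <- repr x].
Definition tensor_opp (x : tensor) : tensor := tensor_scale (-1) x.

Lemma tclassP s t : tclass s = tclass t <-> tensor_eq s t.
Proof.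
split=> [/eqmodP /asboolP //|st]; apply/eqmodP; exact/asboolP.
Qed.

Lemma tclass_repr x : tclass (repr x) = x.
Proof. by rewrite /tclass reprK. Qed.

Lemma repr_tclass s : tensor_eq (repr (tclass s)) s.
Proof. by apply/tclassP; rewrite tclass_repr. Qed.

Lemma tclassW (P : tensor -> Prop) : (forall s, P (tclass s)) -> forall x, P x.
Proof. by move=> H x; rewrite -(tclass_repr x). Qed.

Lemma tclass_cat s t : tensor_add (tclass s) (tclass t) = tclass (s ++ t).
Proof. by apply/tclassP; apply: Teq_cat; exact: repr_tclass. Qed.

Lemma tensor_eq_map c s t : tensor_eq s t ->
  tensor_eq [seq (c *: p.1, p.2) | p <- s] [seq (c *: p.1, p.2) | p <- t].
Proof.
elim=> //=; do ?[by move=> *; econstructor; eauto].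
- by move=> ? ? ? ? _ h1 _ h2; rewrite !map_cat; apply: Teq_cat.
- by move=> ? ?; rewrite !map_cat; apply: Teq_catC.
- by move=> u u' v; rewrite scalerDr; apply: Teq_addl.
- by move=> d u v; rewrite scalerA mulrC -scalerA; apply: Teq_scale.
Qed.

Lemma tclass_scale c s :
  tensor_scale c (tclass s) = tclass [seq (c *: p.1, p.2) | p <- s].
Proof. by apply/tclassP; apply: tensor_eq_map; exact: repr_tclass. Qed.

Lemma tensor_addA : associative tensor_add.
Proof.
by elim/tclassW=> s; elim/tclassW=> t; elim/tclassW=> w; rewrite !tclass_cat catA.
Qed.

Lemma tensor_addC : commutative tensor_add.
Proof.
elim/tclassW=> s; elim/tclassW=> t; rewrite !tclass_cat.
by apply/tclassP; exact: Teq_catC.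
Qed.

Lemma tensor_add0 : left_id (tclass [::]) tensor_add.
Proof. by elim/tclassW=> s; rewrite tclass_cat. Qed.

Lemma Teq_zerol v : tensor_eq [:: (0, v)] [::].
Proof.
rewrite -(scale0r (0 : U)); apply: Teq_trans (Teq_scale _ _ _) _.
by rewrite scale0r; exact: Teq_zero.
Qed.

Lemma tensor_addN : left_inverse (tclass [::]) tensor_opp tensor_add.
Proof.
elim/tclassW=> s; rewrite /tensor_opp tclass_scale tclass_cat; apply/tclassP.
elim: s => [|[u v] s IHs] /=; first exact: Teq_refl.
set m := map _ _ in IHs *; rewrite -cat1s -[(u, v) :: s]cat1s.
have h1 : tensor_eq (m ++ [:: (u, v)] ++ s) ([:: (u, v)] ++ m ++ s).
  by rewrite !catA; apply: Teq_cat (Teq_refl _); exact: Teq_catC.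
apply: Teq_trans (Teq_cat (Teq_refl _) h1) _; rewrite catA -[[::]]cats0.
apply: Teq_cat IHs => /=; apply: Teq_trans (Teq_sym (Teq_addl _ _ _)) _.
by rewrite scaleN1r addNr; exact: Teq_zerol.
Qed.

HB.instance Definition _ :=
  GRing.isZmodule.Build tensor tensor_addA tensor_addC tensor_add0 tensor_addN.

Lemma tensor_scaleA a b x :
  tensor_scale a (tensor_scale b x) = tensor_scale (a * b) x.
Proof.
elim/tclassW: x => s; rewrite !tclass_scale -map_comp; congr tclass.
by apply: eq_map => p /=; rewrite scalerA.
Qed.

Lemma tensor_scale1 : left_id 1 tensor_scale.
Proof.
elim/tclassW=> s; rewrite tclass_scale; congr tclass.
by rewrite -[RHS]map_id; apply: eq_map => -[u v] /=; rewrite scale1r.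
Qed.

Lemma tensor_scaleDr : right_distributive tensor_scale +%R.
Proof.
move=> a; elim/tclassW=> s; elim/tclassW=> t.
by rewrite /GRing.add /= !(tclass_scale, tclass_cat) map_cat.
Qed.

Lemma tensor_scaleDl x : {morph tensor_scale^~ x : a b / a + b}.
Proof.
move=> a b; elim/tclassW: x => s; rewrite /GRing.add /= !(tclass_scale, tclass_cat).
apply/tclassP; elim: s => [|[u v] s IHs] /=; first exact: Teq_refl.
set m := map _ s; set m1 := map _ s in IHs *; set m2 := map _ s in IHs *.
rewrite -cat1s -[_ :: m1 ++ _]cat1s -[_ :: m2]cat1s.
have h1 : tensor_eq (m1 ++ [:: (b *: u, v)] ++ m2) ([:: (b *: u, v)] ++ m1 ++ m2).
  by rewrite !catA; apply: Teq_cat (Teq_refl _); exact: Teq_catC.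
apply: Teq_sym; apply: Teq_trans (Teq_cat (Teq_refl _) h1) _; rewrite catA.
apply: Teq_cat (Teq_sym IHs) => /=; apply: Teq_trans (Teq_sym (Teq_addl _ _ _)) _.
by rewrite scalerDl; exact: Teq_refl.
Qed.

HB.instance Definition _ := GRing.Zmodule_isLmodule.Build k tensor
  tensor_scaleA tensor_scale1 tensor_scaleDr tensor_scaleDl.

Definition tens (u : U) (v : V) : tensor := tclass [:: (u, v)].

End TensorDef.

Notation "u ⊗ v" := (tens u v) : ring_scope.

Section TensorTheory.
Variables (k : fieldType) (U V : lmodType k).

Lemma tensDl (v : V) : {morph (fun u : U => u ⊗ v) : u u' / u + u'}.
Proof.
move=> u u'; rewrite /GRing.add /= /tens tclass_cat.
by apply/tclassP; exact: Teq_addl.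
Qed.

Lemma tensDr (u : U) : {morph (fun v : V => u ⊗ v) : v v' / v + v'}.
Proof.
move=> v v'; rewrite [in RHS]/GRing.add /= /tens tclass_cat.
by apply/tclassP; exact: Teq_addr.
Qed.

Lemma tensZl c (u : U) (v : V) : (c *: u) ⊗ v = c *: (u ⊗ v).
Proof. by rewrite [in RHS]/GRing.scale /= /tens tclass_scale. Qed.

Lemma tensZr c (u : U) (v : V) : u ⊗ (c *: v) = c *: (u ⊗ v).
Proof.
by rewrite -tensZl; apply/tclassP; apply: Teq_sym; exact: Teq_scale.
Qed.

Lemma tclass_sum (s : seq (U * V)) : tclass s = \sum_(p <- s) p.1 ⊗ p.2.
Proof.
elim: s => [|[u v] s IHs]; first by rewrite big_nil.
by rewrite big_cons -IHs [in RHS]/GRing.add /= /tens tclass_cat.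
Qed.

Lemma tensor_repr (x : tensor U V) : x = \sum_(p <- repr x) p.1 ⊗ p.2.
Proof. by rewrite -tclass_sum tclass_repr. Qed.

(* The extension of f to tensors; [tensor_lift (fun x y => E) (comul h)] is   *)
(* what Sweedler's notation writes as E with x := h_(1), y := h_(2).  It is   *)
(* independent of the chosen representative as soon as f is bilinear          *)
(* (lemmas tensor_liftE and tensor_lift_linear).                              *)
Definition tensor_lift (W : nmodType) (f : U -> V -> W) (x : tensor U V) : W :=
  \sum_(p <- repr x) f p.1 p.2.

Variable W : lmodType k.
Implicit Type f : U -> V -> W.

Let bilin f := bilinear_for *:%R *:%R f.

Let biDl f : bilin f -> forall u u' v, f (u + u') v = f u v + f u' v.
Proof. by move=> [fl _] u u' v; have /= := fl v 1 u u'; rewrite !scale1r. Qed.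

Let biDr f : bilin f -> forall u v v', f u (v + v') = f u v + f u v'.
Proof. by move=> [_ fr] u v v'; have /= := fr u 1 v v'; rewrite !scale1r. Qed.

Let biZl f : bilin f -> forall c u v, f (c *: u) v = c *: f u v.
Proof. by move=> [fl _] c u v; exact: (scalable_linear (fl v)). Qed.

Let biZr f : bilin f -> forall c u v, f u (c *: v) = c *: f u v.
Proof. by move=> [_ fr] c u v; exact: (scalable_linear (fr u)). Qed.

Lemma tensor_eq_lift f s t : bilin f -> tensor_eq s t ->
  \sum_(p <- s) f p.1 p.2 = \sum_(p <- t) f p.1 p.2.
Proof.
move=> fb; elim=> {s t}.
- by [].
- by [].
- by move=> s t w _ -> _ ->.
- by move=> s s' t t' _ h _ h'; rewrite !big_cat /= h h'.
- by move=> s t; rewrite !big_cat /= addrC.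
- by move=> u u' v; rewrite !big_cons !big_nil /= !addr0 biDl.
- by move=> u v v'; rewrite !big_cons !big_nil /= !addr0 biDr.
- by move=> c u v; rewrite !big_cons !big_nil /= !addr0 biZl ?biZr.
- by move=> u; rewrite big_cons !big_nil /= addr0 -(scale0r 0) biZr ?scale0r.
Qed.

Lemma tensor_lift_tclass f s : bilin f ->
  tensor_lift f (tclass s) = \sum_(p <- s) f p.1 p.2.
Proof. by move=> fb; apply: tensor_eq_lift => //; exact: repr_tclass. Qed.

Lemma tensor_liftE f u v : bilin f -> tensor_lift f (u ⊗ v) = f u v.
Proof. by move=> fb; rewrite tensor_lift_tclass // big_seq1. Qed.

Lemma tensor_lift_linear f : bilin f -> linear (tensor_lift f).
Proof.
move=> fb c; elim/tclassW=> s; elim/tclassW=> t.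
rewrite /GRing.add [in LHS]/GRing.scale /= tclass_scale tclass_cat.
rewrite !tensor_lift_tclass // big_cat /= big_map scaler_sumr; congr (_ + _).
by apply: eq_bigr => p _ /=; rewrite biZl.
Qed.

Lemma tensor_lift_ext f g : f =2 g -> tensor_lift f =1 tensor_lift g.
Proof. by move=> fg x; apply: eq_bigr. Qed.

End TensorTheory.

Section TensorIdentities.
Variable k : fieldType.

Lemma tens_bilinear (U V : lmodType k) :
  bilinear_for *:%R *:%R (@tens k U V).
Proof.
split=> [v c u u'|u c v v'] /=; first by rewrite tensDl tensZl.
by rewrite tensDr tensZr.
Qed.

Lemma linear_tensor_lift (U V W W' : lmodType k) (g : W -> W')
    (f : U -> V -> W) x :
  linear g -> g (tensor_lift f x) = tensor_lift (fun u v => g (f u v)) x.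
Proof.
move=> gl; rewrite /tensor_lift; apply: big_morph => [u v|].
  by have := gl 1 u v; rewrite !scale1r.
have : g (0 *: 0) = 0 *: g 0 by exact: (scalable_linear gl).
by rewrite !scale0r.
Qed.

Lemma linear_tensor_ext (U V W : lmodType k) (f g : tensor U V -> W) :
  linear f -> linear g -> (forall u v, f (u ⊗ v) = g (u ⊗ v)) -> f =1 g.
Proof.
move=> fl gl fg x.
have -> : x = tensor_lift (@tens k U V) x by exact: tensor_repr.
by rewrite !linear_tensor_lift //; exact: tensor_lift_ext.
Qed.

Lemma tensor_lift_linear_fun (U V W Z : lmodType k) (f : Z -> U -> V -> W) x :
  (forall u v, linear (fun z => f z u v)) -> linear (fun z => tensor_lift (f z) x).
Proof.
move=> fl c z z'; rewrite /tensor_lift scaler_sumr -big_split /=.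
by apply: eq_bigr => p _; rewrite fl.
Qed.

Lemma exchange_tensor_lift (U V U' V' W : lmodType k)
    (f : U -> V -> U' -> V' -> W) x y :
  tensor_lift (fun u v => tensor_lift (f u v) y) x =
  tensor_lift (fun u' v' => tensor_lift (fun u v => f u v u' v') x) y.
Proof. by rewrite /tensor_lift exchange_big. Qed.

End TensorIdentities.

Section TensorMul.
Variables (k : fieldType) (A B : algType k).

Definition tensor_mul (x y : tensor A B) : tensor A B :=
  tensor_lift (fun a b =>
    tensor_lift (fun a' b' => (a * a') ⊗ (b * b')) y) x.

End TensorMul.

HB.mixin Record Algebra_isHopf (k : fieldType) U of GRing.Algebra k U := {
  comul : U -> tensor U U;
  counit : U -> k;
  antipode : U -> U;
  comul_linear : linear comul;
  comul1 : comul 1 = 1 ⊗ 1;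
  comulM : forall h g, comul (h * g) = tensor_mul (comul h) (comul g);
  counit_linear : linear_for *%R counit;
  counit1 : counit 1 = 1;
  counitM : forall h g, counit (h * g) = counit h * counit g;
  comulA : forall h,
    tensor_lift (fun x z => tensor_lift (fun x' y => x' ⊗ (y ⊗ z)) (comul x))
      (comul h) =
    tensor_lift (fun x y => tensor_lift (fun y' z => x ⊗ (y' ⊗ z)) (comul y))
      (comul h);
  counitl : forall h, tensor_lift (fun x y => counit x *: y) (comul h) = h;
  counitr : forall h, tensor_lift (fun x y => counit y *: x) (comul h) = h;
  antipode_linear : linear antipode;
  antipodel : forall h,
    tensor_lift (fun x y => antipode x * y) (comul h) = counit h *: 1;
  antipoder : forall h,
    tensor_lift (fun x y => x * antipode y) (comul h) = counit h *: 1
}.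

#[short(type="hopfAlgType")]
HB.structure Definition HopfAlgebra (k : fieldType) :=
  {U of Algebra_isHopf k U & GRing.Algebra k U}.

HB.mixin Record Algebra_isModuleAlgebra (k : fieldType) (U : hopfAlgType k) A
    of GRing.Algebra k A := {
  act : U -> A -> A;
  act_bilinear : bilinear_for *:%R *:%R act;
  act1l : forall a, act 1 a = a;
  actMl : forall h g a, act (h * g) a = act h (act g a);
  act1r : forall h, act h 1 = counit h *: 1;
  actMr : forall h a b,
    act h (a * b) = tensor_lift (fun x y => act x a * act y b) (comul h)
}.

#[short(type="moduleAlgType")]
HB.structure Definition ModuleAlgebra (k : fieldType) (U : hopfAlgType k) :=
  {A of Algebra_isModuleAlgebra k U A & GRing.Algebra k A}.

Notation "h ▷ a" := (act h a) : ring_scope.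

Section HopfTheory.
Variables (k : fieldType) (U : hopfAlgType k) (A : moduleAlgType U).

HB.instance Definition _ :=
  GRing.isLinear.Build k U (tensor U U) *:%R comul comul_linear.
HB.instance Definition _ := GRing.isLinear.Build k U k *%R counit counit_linear.

Lemma actDl (a : A) (h g : U) : (h + g) ▷ a = h ▷ a + g ▷ a.
Proof. by have /= := act_bilinear.1 a 1 h g; rewrite !scale1r. Qed.

Lemma actDr (h : U) (a b : A) : h ▷ (a + b) = h ▷ a + h ▷ b.
Proof. by have /= := act_bilinear.2 h 1 a b; rewrite !scale1r. Qed.

Lemma actZl (a : A) c (h : U) : (c *: h) ▷ a = c *: (h ▷ a).
Proof. exact: (scalable_linear (act_bilinear.1 a)). Qed.

Lemma actZr c (h : U) (a : A) : h ▷ (c *: a) = c *: (h ▷ a).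
Proof. exact: (scalable_linear (act_bilinear.2 h)). Qed.

Lemma tensor_lift_mul (W : lmodType k) (f : U -> U -> W) x y :
  bilinear_for *:%R *:%R f ->
  tensor_lift f (tensor_mul x y) =
  tensor_lift (fun a b => tensor_lift (fun a' b' => f (a * a') (b * b')) y) x.
Proof.
move=> fb; have fl := tensor_lift_linear fb.
rewrite /tensor_mul linear_tensor_lift //; apply: tensor_lift_ext => a b.
rewrite linear_tensor_lift //; apply: tensor_lift_ext => a' b'.
by rewrite tensor_liftE.
Qed.

End HopfTheory.

(* The crossed product A # U: the vector space A ⊗ U with the multiplication  *)
(* (a ⊗ h) (b ⊗ g) = a (h_(1) ▷ b) ⊗ h_(2) g                                  *)
Definition crossed (k : fieldType) (U : hopfAlgType k) (A : moduleAlgType U) :=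
  tensor A U.

Section Crossed.
Variables (k : fieldType) (U : hopfAlgType k) (A : moduleAlgType U).
Local Notation D := (crossed A).

HB.instance Definition _ := GRing.Lmodule.on D.

Definition crossed_mul (x y : D) : D :=
  tensor_lift (fun a h =>
    tensor_lift (fun b g =>
      tensor_lift (fun h1 h2 => (a * (h1 ▷ b)) ⊗ (h2 * g)) (comul h)) y) x.

Definition crossed1 : D := 1 ⊗ 1.

Let core (a : A) (h : U) (b : A) (g : U) : D :=
  tensor_lift (fun h1 h2 => (a * (h1 ▷ b)) ⊗ (h2 * g)) (comul h).

Let core_bil a b g :
  bilinear_for *:%R *:%R (fun h1 h2 : U => (a * (h1 ▷ b)) ⊗ (h2 * g) : D).
Proof.
split=> [h2 c h h'|h1 c h h'] /=.
  by rewrite actDl actZl mulrDr -scalerAr tensDl tensZl.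
by rewrite mulrDl -scalerAl tensDr tensZr.
Qed.

Let core_lin_a h b g : linear (fun a => core a h b g).
Proof.
apply: tensor_lift_linear_fun => h1 h2 c a a' /=.
by rewrite mulrDl -scalerAl tensDl tensZl.
Qed.

Let core_lin_h a b g : linear (fun h => core a h b g).
Proof.
move=> c h h'; rewrite /core linearP.
exact: (tensor_lift_linear (core_bil a b g)).
Qed.

Let core_lin_b a h g : linear (fun b => core a h b g).
Proof.
apply: tensor_lift_linear_fun => h1 h2 c b b' /=.
by rewrite actDr actZr mulrDr -scalerAr tensDl tensZl.
Qed.

Let core_lin_g a h b : linear (core a h b).
Proof.
apply: tensor_lift_linear_fun => h1 h2 c g g' /=.
by rewrite mulrDr -scalerAr tensDr tensZr.
Qed.

Let mul_linl y : linear (crossed_mul^~ y).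
Proof.
apply: tensor_lift_linear; split=> [h c a a'|a c h h'] /=.
  exact: (tensor_lift_linear_fun (f := fun a => core a h)).
exact: (tensor_lift_linear_fun (f := core a)).
Qed.

Let mul_linr x : linear (crossed_mul x).
Proof.
move=> c y y'; rewrite /crossed_mul.
apply: (tensor_lift_linear_fun (f := fun y a h => tensor_lift (core a h) y)).
move=> a h; apply: tensor_lift_linear; split=> [g|b] /=.
  exact: core_lin_b.
exact: core_lin_g.
Qed.

Let mulE a h b g : crossed_mul (a ⊗ h) (b ⊗ g) = core a h b g.
Proof.
rewrite /crossed_mul tensor_liftE; last first.
  split=> [h' c a1 a2|a' c h1 h2] /=.
    exact: (tensor_lift_linear_fun (f := fun a => core a h')).
  exact: (tensor_lift_linear_fun (f := core a')).
by rewrite tensor_liftE //; split=> [g'|b'] /=; [exact: core_lin_b|exact: core_lin_g].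
Qed.

Let comp_lin (X Y Z : lmodType k) (f : Y -> Z) (g : X -> Y) :
  linear f -> linear g -> linear (fun x => f (g x)).
Proof. by move=> fl gl c x y; rewrite gl fl. Qed.

Let comulA_lift (W : lmodType k) (G : U -> U -> U -> W) h :
    (forall y z, linear (fun x => G x y z)) ->
    (forall x z, linear (fun y => G x y z)) -> (forall x y, linear (G x y)) ->
  tensor_lift (fun x z => tensor_lift (fun x' y => G x' y z) (comul x)) (comul h) =
  tensor_lift (fun x y => tensor_lift (fun y' z => G x y' z) (comul y)) (comul h).
Proof.
move=> G1 G2 G3.
have bG x : bilinear_for *:%R *:%R (G x) by split.
have bL : bilinear_for *:%R *:%R (fun x => tensor_lift (G x)).
  split=> [w|x]; last exact: tensor_lift_linear.
  exact: tensor_lift_linear_fun.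
pose L := tensor_lift (fun x => tensor_lift (G x)).
have Ll : linear L by exact: tensor_lift_linear.
have LE x y z : L (x ⊗ (y ⊗ z)) = G x y z by rewrite /L !tensor_liftE.
have := congr1 L (comulA h); rewrite !(linear_tensor_lift _ _ Ll) => E.
apply: etrans (etrans _ E) _.
  apply: tensor_lift_ext => x z; rewrite linear_tensor_lift //.
  by apply: tensor_lift_ext => x' y; rewrite LE.
apply: tensor_lift_ext => x y; rewrite linear_tensor_lift //.
by apply: tensor_lift_ext => y' z; rewrite LE.
Qed.

Let ext3 (f g : D -> D -> D -> D) :
    (forall y z, linear (fun x => f x y z)) ->
    (forall x z, linear (fun y => f x y z)) -> (forall x y, linear (f x y)) ->
    (forall y z, linear (fun x => g x y z)) ->
    (forall x z, linear (fun y => g x y z)) -> (forall x y, linear (g x y)) ->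
    (forall (a b c : A) (h l m : U),
       f (a ⊗ h) (b ⊗ l) (c ⊗ m) = g (a ⊗ h) (b ⊗ l) (c ⊗ m)) ->
  forall x y z, f x y z = g x y z.
Proof.
move=> f1 f2 f3 g1 g2 g3 E x y z.
move: x; apply: linear_tensor_ext => // a h.
move: y; apply: linear_tensor_ext => // b l.
by move: z; apply: linear_tensor_ext.
Qed.

Let mulA : associative crossed_mul.
Proof.
move=> x y z; move: x y z; apply: ext3.
- by move=> y z; exact: mul_linl.
- by move=> x z; apply: comp_lin; [exact: mul_linr|exact: mul_linl].
- by move=> x y; apply: comp_lin; exact: mul_linr.
- by move=> y z; apply: (comp_lin (mul_linl z)); exact: mul_linl.
- by move=> x z; apply: (comp_lin (mul_linl z)); exact: mul_linr.
- by move=> x y; exact: mul_linr.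
move=> a b c h g m; rewrite !mulE.
rewrite /core (linear_tensor_lift _ _ (mul_linr (a ⊗ h))).
rewrite (linear_tensor_lift _ _ (mul_linl (c ⊗ m))).
transitivity (tensor_lift (fun x y : U => tensor_lift (fun x1 x2 =>
    tensor_lift (fun s t => (a * ((x1 ▷ b) * (x2 ▷ s ▷ c))) ⊗ (y * (t * m)) : D)
    (comul g)) (comul x)) (comul h)).
  transitivity (tensor_lift (fun s t : U => tensor_lift (fun x y : U =>
      tensor_lift (fun x1 x2 =>
      (a * ((x1 ▷ b) * (x2 ▷ s ▷ c))) ⊗ (y * (t * m)) : D) (comul x))
      (comul h)) (comul g)).
    apply: tensor_lift_ext => s t; rewrite mulE /core.
    apply: tensor_lift_ext => x y; rewrite actMr.
    rewrite (linear_tensor_lift (g := fun w : A => (a * w) ⊗ (y * (t * m)))) //.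
    by move=> d w w'; rewrite mulrDr -scalerAr tensDl tensZl.
  rewrite exchange_tensor_lift; apply: tensor_lift_ext => x y.
  by rewrite exchange_tensor_lift.
transitivity (tensor_lift (fun x y : U => tensor_lift (fun y1 y2 =>
    tensor_lift (fun s t => (a * ((x ▷ b) * (y1 ▷ s ▷ c))) ⊗ (y2 * (t * m)) : D)
    (comul g)) (comul y)) (comul h)).
  apply: (comulA_lift (G := fun x1 x2 y => tensor_lift (fun s t =>
    (a * ((x1 ▷ b) * (x2 ▷ s ▷ c))) ⊗ (y * (t * m)) : D) (comul g))).
  - move=> y z; apply: tensor_lift_linear_fun => s t d w w' /=.
    by rewrite actDl actZl mulrDl mulrDr -scalerAl -scalerAr tensDl tensZl.
  - move=> y z; apply: tensor_lift_linear_fun => s t d w w' /=.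
    by rewrite actDl actZl !mulrDr -!scalerAr tensDl tensZl.
  - move=> y z; apply: tensor_lift_linear_fun => s t d w w' /=.
    by rewrite mulrDl -scalerAl tensDr tensZr.
apply: tensor_lift_ext => x y; rewrite mulE /core comulM tensor_lift_mul //.
apply: tensor_lift_ext => y1 y2; apply: tensor_lift_ext => s t.
by rewrite actMl !mulrA.
Qed.

Let mul1l : left_id crossed1 crossed_mul.
Proof.
move=> x; move: x; apply: linear_tensor_ext => [|//|b g]; first exact: mul_linr.
by rewrite mulE /core comul1 tensor_liftE // act1l !mul1r.
Qed.

Let mulr1_ : right_id crossed1 crossed_mul.
Proof.
move=> x; move: x; apply: linear_tensor_ext => [|//|a h]; first exact: mul_linl.
rewrite mulE /core -[in RHS](counitl h) linear_tensor_lift.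
  apply: tensor_lift_ext => x y.
  by rewrite act1r mulr1 -scalerAr mulr1 tensZl tensZr.
by move=> c g g'; rewrite tensDr tensZr.
Qed.

Let linD (f : D -> D) : linear f -> {morph f : x y / x + y}.
Proof. by move=> fl x y; have := fl 1 x y; rewrite !scale1r. Qed.

Let mulDl : left_distributive crossed_mul +%R.
Proof. by move=> x y z; exact: (linD (mul_linl z)). Qed.

Let mulDr : right_distributive crossed_mul +%R.
Proof. by move=> x y z; exact: (linD (mul_linr x)). Qed.

Let crossed1_neq0 : crossed1 != 0.
Proof.
pose f (a : A) (h : U) : A := counit h *: a.
have fb : bilinear_for *:%R *:%R f.
  split=> [h c a b|a c h g]; rewrite /f /=.
    by rewrite scalerDr !scalerA mulrC.
  by rewrite linearP scalerDl scalerA.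
apply/eqP => /(congr1 (tensor_lift f)); rewrite tensor_liftE // /f counit1.
have -> : tensor_lift f 0 = 0.
  have := tensor_lift_linear fb (-1) 0 0.
  by rewrite scaler0 addr0 scaleN1r addNr.
by rewrite scale1r; apply/eqP; exact: oner_neq0.
Qed.

HB.instance Definition _ := GRing.Zmodule_isNzRing.Build D
  mulA mul1l mulr1_ mulDl mulDr crossed1_neq0.

Let scaleAl (c : k) (x y : D) : c *: (x * y) = (c *: x) * y.
Proof. by rewrite [in RHS]/GRing.mul /= (scalable_linear (mul_linl y)). Qed.

Let scaleAr (c : k) (x y : D) : c *: (x * y) = x * (c *: y).
Proof. by rewrite [in RHS]/GRing.mul /= (scalable_linear (mul_linr x)). Qed.

HB.instance Definition _ := GRing.LSemiModule_isLSemiAlgebra.Build k D scaleAl.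
HB.instance Definition _ := GRing.LSemiAlgebra_isSemiAlgebra.Build k D scaleAr.

Definition inA (a : A) : D := a ⊗ 1.
Definition inU (h : U) : D := 1 ⊗ h.

Lemma crossed_mulE (a b : A) (h g : U) :
  (a ⊗ h : D) * (b ⊗ g) =
  tensor_lift (fun h1 h2 => (a * (h1 ▷ b)) ⊗ (h2 * g)) (comul h).
Proof. exact: mulE. Qed.

Lemma inA_inU a h : inA a * inU h = a ⊗ h.
Proof.
by rewrite crossed_mulE comul1 tensor_liftE // act1l mulr1 mul1r.
Qed.

Lemma inAM a b : inA (a * b) = inA a * inA b.
Proof.
by rewrite crossed_mulE comul1 tensor_liftE // act1l mulr1.
Qed.

Lemma inUM h g : inU (h * g) = inU h * inU g.
Proof.
rewrite crossed_mulE -[in LHS](counitl h).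
rewrite (linear_tensor_lift (g := fun w : U => inU (w * g))).
  apply: tensor_lift_ext => x y; rewrite act1r /inU mul1r.
  by rewrite -scalerAl tensZr tensZl.
by move=> c w w'; rewrite /inU mulrDl -scalerAl tensDr tensZr.
Qed.

Lemma inU_inA h a : inU h * inA a =
  tensor_lift (fun h1 h2 => inA (h1 ▷ a) * inU h2) (comul h).
Proof.
rewrite crossed_mulE; apply: tensor_lift_ext => x y.
by rewrite inA_inU mul1r mulr1.
Qed.

Definition theta (K : U) (x : D) : D :=
  tensor_lift (fun a h => inA (K ▷ a) * inU h) x.

Lemma theta_bilinear K :
  bilinear_for *:%R *:%R (fun (a : A) (h : U) => inA (K ▷ a) * inU h).
Proof.
split=> [h c a b|a c h g] /=; rewrite !inA_inU.
  by rewrite actDr actZr tensDl tensZl.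
by rewrite tensDr tensZr.
Qed.

Lemma theta_linear K : linear (theta K).
Proof. exact: tensor_lift_linear (theta_bilinear K). Qed.

Lemma thetaE K a h : theta K (inA a * inU h) = inA (K ▷ a) * inU h.
Proof. by rewrite inA_inU /theta tensor_liftE //; exact: theta_bilinear. Qed.

(* Written [x, y]_{θ^r}. *)
Definition twisted_comm (K : U) (r : nat) (x y : D) : D :=
  x * y - iter r (theta K) y * x.

End Crossed.

Local Open Scope classical_set_scope.

Section Subspaces.
Variable k : fieldType.

Definition is_subspace (V : lmodType k) (S : set V) : Prop :=
  [/\ S 0, (forall u v, S u -> S v -> S (u + v))
         & (forall c v, S v -> S (c *: v))].

Definition lspan (V : lmodType k) (S : set V) : set V := smallest (@is_subspace V) S.

(* The image of S ⊗ T in V ⊗ W. *)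
Definition tensor_set (V W : lmodType k) (S : set V) (T : set W) :
    set (tensor V W) :=
  lspan [set z | exists u v, [/\ S u, T v & z = u ⊗ v]].

End Subspaces.

Section Filtrations.
Variable k : fieldType.

(* Neither exhaustiveness nor (for algebras) 1 in F 0 is required. *)
Definition is_filtration (V : lmodType k) (F : nat -> set V) : Prop :=
  (forall m, is_subspace (F m)) /\ (forall m, F m `<=` F m.+1).

Definition is_algebra_filtration (U : algType k) (F : nat -> set U) : Prop :=
  forall i j x y, F i x -> F j y -> F (i + j)%N (x * y).

Definition is_coalgebra_filtration (U : hopfAlgType k) (F : nat -> set U) : Prop :=
  forall m x, F m x ->
    lspan (\bigcup_(j in [set j | (j <= m)%N])
             tensor_set (F j) (F (m - j)%N)) (comul x).

Definition is_bialgebra_filtration (U : hopfAlgType k) (F : nat -> set U) : Prop :=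
  [/\ is_filtration F, is_algebra_filtration F & is_coalgebra_filtration F].

Definition crossed_filtration (U : hopfAlgType k) (A : moduleAlgType U)
    (F : nat -> set U) (m : nat) : set (crossed A) :=
  lspan [set z | exists (a : A) (h : U), F m h /\ z = inA a * inU A h].

End Filtrations.

(* Main.v *)
Require Import Defs.
From mathcomp Require Import all_boot all_order all_algebra.
From mathcomp Require Import boolp classical_sets.

Set Implicit Arguments.
Unset Strict Implicit.
Unset Printing Implicit Defensive.

Import GRing.Theory.
Local Open Scope classical_set_scope.
Local Open Scope ring_scope.

(* In A # U one has C (a h) = (C_(1) ▷ a) C_(2) h.  The term K^r ⊗ C of the   *)
(* coproduct contributes (K^r ▷ a) C h = θ^r(a h) C, since C is central in U; *)
(* the twisted commutator removes it.  What is left is a sum of terms         *)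
(* (c_j ▷ a) c'_(r-j) h with j >= 1, which lie in degree m + r - j.           *)

(** Both sides are spans and the twisted commutator is linear in its second argument
    ([twisted_comm_linear]), so by [linear_lspan] it suffices to test generators a h. There
    [twisted_commE] leaves only the c_j part of the coproduct, and a second and third use of
    [linear_lspan] reduce that to pure tensors. *)

Section Span.
Variables (k : fieldType) (V W : lmodType k).

Lemma lspan_subspace (S : set V) : is_subspace (lspan S).
Proof.
split=> [T [[T0 _ _] _] //|u v Su Sv T TS|c v Sv T TS].
- by have [_ TD _] := TS.1; apply: TD; [exact: Su|exact: Sv].
- by have [_ _ TZ] := TS.1; apply: TZ; exact: Sv.
Qed.

(** The preimage of a subspace under a linear map is a subspace, so it contains the span of S as
    soon as it contains S. *)
Lemma linear_lspan (f : V -> W) (S : set V) (T : set W) : linear f ->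
  is_subspace T -> (forall x, S x -> T (f x)) -> forall x, lspan S x -> T (f x).
Proof.
move=> fl [T0 TD TZ] ST; apply: smallest_sub => //; split=> [|u v Tu Tv|c v Tv].
- have : f (0 *: 0) = 0 *: f 0 by exact: (scalable_linear fl).
  by rewrite !scale0r => ->.
- by have := fl 1 u v; rewrite !scale1r => ->; apply: TD.
- have -> : f (c *: v) = c *: f v by exact: (scalable_linear fl).
  exact: TZ.
Qed.

Lemma subspace_sum (T : set V) (I : eqType) (s : seq I) (x : I -> V) :
  is_subspace T -> (forall i, i \in s -> T (x i)) -> T (\sum_(i <- s) x i).
Proof. by move=> [T0 TD _] Tx; rewrite big_seq; apply: big_ind. Qed.

Lemma filtration_le (F : nat -> set V) i j x :
  is_filtration F -> (i <= j)%N -> F i x -> F j x.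
Proof.
move=> [_ FS] /subnK <-; elim: (j - i)%N => //= n IHn Fx.
by rewrite addSn; apply: FS; exact: IHn.
Qed.

End Span.

Section Crossed.
Variables (k : fieldType) (U : hopfAlgType k) (A : moduleAlgType U).

Lemma iter_theta_linear (K : U) n : linear (iter n (@theta k U A K)).
Proof.
elim: n => //= n IHn c x y.
exact: etrans (congr1 _ (IHn c x y)) (theta_linear K _ _ _).
Qed.

Lemma iter_thetaE (K : U) n (a : A) (h : U) :
  iter n (theta K) (inA a * inU A h) = inA ((K ^+ n) ▷ a) * inU A h.
Proof.
elim: n => [|n IHn] /=; first by rewrite expr0 act1l.
by rewrite IHn thetaE exprS actMl.
Qed.

Lemma twisted_comm_linear (K : U) r (x : crossed A) :
  linear (twisted_comm K r x).
Proof.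
move=> c y z; rewrite /twisted_comm iter_theta_linear mulrDr mulrDl.
by rewrite -scalerAr -scalerAl scalerBr opprD addrACA.
Qed.

(** Bilinearity makes the Sweedler sum independent of the representative, so [tensor_lift] of this
    map is linear and computable on pure tensors. *)
Lemma smash_bilinear (a : A) (g : U) :
  bilinear_for *:%R *:%R (fun h1 h2 : U => (h1 ▷ a) ⊗ (h2 * g) : crossed A).
Proof.
split=> [h2 c h h'|h1 c h h'] /=; first by rewrite actDl actZl tensDl tensZl.
by rewrite mulrDl -scalerAl tensDr tensZr.
Qed.

Lemma inU_mul (C : U) (a : A) (h : U) :
  inU A C * (inA a * inU A h) =
  tensor_lift (fun h1 h2 => (h1 ▷ a) ⊗ (h2 * h)) (comul C).
Proof.
rewrite inA_inU crossed_mulE; apply: tensor_lift_ext => h1 h2.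
by rewrite mul1r.
Qed.

Lemma twisted_commE (C K : U) r (x : tensor U U) (a : A) (h : U) :
  C * h = h * C -> comul C = (K ^+ r) ⊗ C + x ->
  twisted_comm K r (inU A C) (inA a * inU A h) =
  tensor_lift (fun h1 h2 => (h1 ▷ a) ⊗ (h2 * h)) x.
Proof.
move=> Ch Cx; rewrite /twisted_comm iter_thetaE inU_mul Cx.
have Ll := tensor_lift_linear (smash_bilinear a h).
rewrite -[_ ⊗ C]scale1r Ll scale1r tensor_liftE; last exact: smash_bilinear.
(* Centrality turns h C into C h, so the two K^r terms cancel. *)
by rewrite -mulrA -inUM inA_inU Ch; exact: etrans (addrC _ _) (addKr _ _).
Qed.

End Crossed.

Theorem proposition7p3 (k : fieldType) (U : hopfAlgType k) (A : moduleAlgType U)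
    (F : nat -> set U) (hF : is_bialgebra_filtration F)
    (r : nat) (hr : (2 <= r)%N)
    (C : U) (C_order : F r C) (C_central : forall h : U, C * h = h * C)
    (K : U) (K_order : F 0%N K)
    (c : nat -> tensor U U)
    (hc : forall j, (1 <= j <= r)%N -> tensor_set (F j) (F (r - j)%N) (c j))
    (hC : comul C = (K ^+ r) ⊗ C + \sum_(1 <= j < r.+1) c j) :
  forall (m : nat) (y : crossed A),
    crossed_filtration F m y ->
    crossed_filtration F (m + r - 1)%N (twisted_comm K r (inU A C) y).
Proof.
have [Ffilt Fmul _] := hF.
move=> m; apply: linear_lspan (twisted_comm_linear K r _) (lspan_subspace _) _.
move=> _ [a [h [Fh ->]]]; rewrite (twisted_commE _ (C_central h) hC).
have fb := smash_bilinear a h; have Lf := tensor_lift_linear fb.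
(* One spanning set for all j at once, so that [linear_lspan] can treat a single j. *)
have : lspan [set x | exists j, (1 <= j <= r)%N /\
    tensor_set (F j) (F (r - j)%N) x] (\sum_(1 <= j < r.+1) c j).
  apply: (subspace_sum (lspan_subspace _)) => j; rewrite mem_index_iota => jr.
  by apply: sub_gen_smallest; exists j; split=> //; apply: hc.
apply: (linear_lspan Lf (lspan_subspace _)) => // x [j [/andP[j1 jr]]].
move: x; apply: (linear_lspan Lf (lspan_subspace _)) => // _ [u [v [_ Fv ->]]].
(* As A has degree 0, only the degree of v * h counts, namely (r - j) + m. *)
rewrite tensor_liftE //; apply: sub_gen_smallest; exists (u ▷ a), (v * h).
split; last by rewrite inA_inU.
apply: (filtration_le Ffilt _ (Fmul _ _ _ _ Fv Fh)).
(* The drop by one is j >= 1; together with j <= r it also gives 1 <= r, which the truncated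
   subtraction requires. *)
by rewrite -addnBA ?(leq_trans j1) // addnC leq_add2l leq_sub2l.
Qed.
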